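(* Let $A=\sigma(R)\langle x_1,\dots,x_n\rangle$ be a skew PBW extension over a ring $R$, with associated family of endomorphisms $\Sigma$ of $R$, and suppose that $R$ is $\Sigma$-semicommutative and reduced. Then the following statements are equivalent: (1) $A$ is J-pm. (2) $\text{J-}\mathrm{Spec}(A)$ is normal. (3) $\mathrm{Max}(A)$ is a retract of $\text{J-}\mathrm{Spec}(A)$.
   Context: Rings are associative with identity; ideals are two-sided; $\mathbb{N}$ includes $0$; $J(B)$ is the Jacobson radical of a ring $B$. A ring is reduced if it has no nonzero nilpotent elements. Skew PBW extension: $A=\sigma(R)\langle x_1,\dots,x_n\rangle$ is a skew PBW extension over $R$ if (i) $R$ is a subring of $A$ with the same identity; (ii) there are $x_1,\dots,x_n\in A$ such that $A$ is a free left $R$-module with basis $\mathrm{Mon}(A):=\{x^\alpha:=x_1^{\alpha_1}\cdots x_n^{\alpha_n}\mid \alpha=(\alpha_1,\dots,\alpha_n)\in\mathbb{N}^n\}$; (iii) for each $i$ and each $r\in R\setminus\{0\}$ there is $c_{i,r}\in R\setminus\{0\}$ with $x_ir-c_{i,r}x_i\in R$; (iv) for all $1\le i,j\le n$ there is $d_{i,j}\in R\setminus\{0\}$ with $x_jx_i-d_{i,j}x_ix_j\in R+Rx_1+\cdots+Rx_n$. For such $A$, for each $i$ there are an injective ring endomorphism $\sigma_i$ of $R$ and a $\sigma_i$-derivation $\delta_i$ of $R$ (an additive map with $\delta_i(rs)=\sigma_i(r)\delta_i(s)+\delta_i(r)s$) such that $x_ir=\sigma_i(r)x_i+\delta_i(r)$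 for all $r\in R$. Put $\Sigma:=\{\sigma_1,\dots,\sigma_n\}$, and for $\alpha\in\mathbb{N}^n$, $\sigma^\alpha:=\sigma_1^{\alpha_1}\circ\cdots\circ\sigma_n^{\alpha_n}$. $R$ is $\Sigma$-semicommutative if for all $a,b\in R$, $ab=0$ implies $aR\sigma^\alpha(b)=0$ for every $\alpha\in\mathbb{N}^n\setminus\{0\}$. An ideal $P$ of a ring $B$ is J-prime if $P$ is prime and $J(B/P)=0$ (maximal ideals are J-prime). A ring is J-pm if every J-prime ideal is contained in a unique maximal ideal. $\text{J-}\mathrm{Spec}(A)$ is the set of J-prime ideals of $A$, with the topology whose open sets are $D(I)=\{P\in\text{J-}\mathrm{Spec}(A)\mid I\nsubseteq P\}$ for ideals $I$ of $A$; $\mathrm{Max}(A)\subseteq\text{J-}\mathrm{Spec}(A)$ is the set of maximal ideals with the subspace topology. Retract: there is a continuous map $\text{J-}\mathrm{Spec}(A)\to\mathrm{Max}(A)$ that is the identity on $\mathrm{Max}(A)$. Normal: disjoint closed sets have disjoint open neighbourhoods ($T_1$ not required). *)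

(* Defs.v *)
From HB Require Import structures.
From mathcomp Require Import all_boot all_order all_algebra.
From mathcomp Require Import generic_quotient ring_quotient.
From mathcomp Require Import all_classical all_reals all_analysis.

Set Implicit Arguments.
Unset Strict Implicit.
Unset Printing Implicit Defensive.

Import GRing.Theory.

Local Open Scope classical_set_scope.
Local Open Scope ring_scope.
Local Open Scope quotient_scope.

(** ** Ideals and quotients of noncommutative rings *)

(* Two-sided, possibly improper. *)
Record ideal (B : pzRingType) := Ideal {
  ideal_set :> set B;
  ideal0 : ideal_set 0;
  idealB : forall a b, ideal_set a -> ideal_set b -> ideal_set (a - b);
  idealMl : forall r a, ideal_set a -> ideal_set (r * a);
  idealMr : forall a r, ideal_set a -> ideal_set (a * r)
}.

Lemma ideal_ext (B : pzRingType) (I J : ideal B) :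
  (I : set B) = (J : set B) -> I = J.
Proof.
case: I J => [I I0 IB Il Ir] [J J0 JB Jl Jr] /= IJ; subst J.
by congr Ideal; exact: Prop_irrelevance.
Qed.

Lemma idealN (B : pzRingType) (I : ideal B) (a : B) :
  (I : set B) a -> (I : set B) (- a).
Proof. by move=> Ia; rewrite -sub0r; apply: idealB => //; exact: ideal0. Qed.

Definition ideal_pred (B : pzRingType) (I : ideal B) : {pred B} :=
  [pred a | `[< (I : set B) a >]].

Lemma ideal_pred_zmod_closed (B : pzRingType) (I : ideal B) :
  zmod_closed (ideal_pred I).
Proof.
split; first by apply/asboolP; exact: ideal0.
by move=> a b /asboolP Ia /asboolP Ib; apply/asboolP; exact: idealB.
Qed.

HB.instance Definition _ (B : pzRingType) (I : ideal B) :=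
  GRing.isZmodClosed.Build B (ideal_pred I) (ideal_pred_zmod_closed I).

(* The library's additive quotient, on which the library only puts a ring
   structure when the ring is commutative and the ideal proper. *)
Definition ring_quot (B : pzRingType) (I : ideal B) : Type :=
  Quotient.quot (ideal_pred I).

Section RingQuot.
Variables (B : pzRingType) (I : ideal B).
Local Notation Q := (ring_quot I).

HB.instance Definition _ := Choice.copy Q (Quotient.quot (ideal_pred I)).
HB.instance Definition _ :=
  ZmodQuotient.copy Q (Quotient.quot (ideal_pred I)).

Lemma quot_eqP (x y : B) :
  reflect ((I : set B) (x - y)) (x == y %[mod Q]).
Proof. rewrite -Quotient.idealrBE; exact: asboolP. Qed.

Definition quot_one : Q := \pi_Q 1.
Definition quot_mul (x y : Q) : Q := \pi_Q (repr x * repr y).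

Lemma quot_mulE (x y : B) : \pi_Q (x * y) = quot_mul (\pi_Q x) (\pi_Q y).
Proof.
apply/eqP/quot_eqP; set x' := repr _; set y' := repr _.
have Ix : (I : set B) (x - x') by apply/quot_eqP; rewrite reprK.
have Iy : (I : set B) (y - y') by apply/quot_eqP; rewrite reprK.
have -> : x * y - x' * y' = x * (y - y') - - ((x - x') * y').
  by rewrite opprK mulrBr mulrBl addrA subrK.
apply: idealB; first exact: idealMl.
by apply: idealN; exact: idealMr.
Qed.

Fact quot_mulA : associative quot_mul.
Proof.
elim/quotW=> x; elim/quotW=> y; elim/quotW=> z.
by rewrite -[quot_mul (\pi y) _]quot_mulE -[quot_mul (\pi x) (\pi y)]quot_mulE
  -[LHS]quot_mulE -[RHS]quot_mulE mulrA.
Qed.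

Fact quot_mul1l : left_id quot_one quot_mul.
Proof. by elim/quotW=> x; rewrite -[LHS]quot_mulE mul1r. Qed.

Fact quot_mul1r : right_id quot_one quot_mul.
Proof. by elim/quotW=> x; rewrite -[LHS]quot_mulE mulr1. Qed.

Fact quot_mulDl : left_distributive quot_mul +%R.
Proof.
elim/quotW=> x; elim/quotW=> y; elim/quotW=> z.
by rewrite -raddfD -[LHS]quot_mulE mulrDl raddfD; congr (_ + _);
  exact: quot_mulE.
Qed.

Fact quot_mulDr : right_distributive quot_mul +%R.
Proof.
elim/quotW=> x; elim/quotW=> y; elim/quotW=> z.
by rewrite -raddfD -[LHS]quot_mulE mulrDr raddfD; congr (_ + _);
  exact: quot_mulE.
Qed.

HB.instance Definition _ := GRing.Zmodule_isPzRing.Build Q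
  quot_mulA quot_mul1l quot_mul1r quot_mulDl quot_mulDr.

Lemma pi_quot0 (x : B) : \pi_Q x = 0 <-> (I : set B) x.
Proof.
split=> [/eqP|Ix].
  by rewrite -(raddf0 \pi_Q) => /quot_eqP; rewrite subr0.
by rewrite -(raddf0 \pi_Q); apply/eqP/quot_eqP; rewrite subr0.
Qed.

Lemma pi_quot1 : \pi_Q 1 = 1. Proof. by []. Qed.

Lemma pi_quotM (x y : B) : \pi_Q (x * y) = \pi_Q x * \pi_Q y.
Proof. exact: quot_mulE. Qed.

End RingQuot.

(** ** Jacobson radical, prime, maximal and J-prime ideals *)

Definition left_ideal (B : pzRingType) (L : set B) : Prop :=
  [/\ L 0, forall a b, L a -> L b -> L (a - b)
    & forall r a, L a -> L (r * a)].

Definition maximal_left_ideal (B : pzRingType) (L : set B) : Prop :=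
  [/\ left_ideal L, L != setT
    & forall K, left_ideal K -> L `<=` K -> K = L \/ K = setT].

Definition jacobson_radical (B : pzRingType) : set B :=
  \bigcap_(L in @maximal_left_ideal B) L.
Arguments jacobson_radical B : clear implicits.

Definition maximal_ideal (B : pzRingType) (M : ideal B) : Prop :=
  (M : set B) != setT /\
  forall K : ideal B, M `<=` K -> K = M \/ (K : set B) = setT.

(* As [P] is closed under addition, the product ideal of [I] and [J] lies in
   [P] as soon as all the products [a * b] do. *)
Definition prime_ideal (B : pzRingType) (P : ideal B) : Prop :=
  (P : set B) != setT /\
  forall I J : ideal B,
    (forall a b, (I : set B) a -> (J : set B) b -> (P : set B) (a * b)) ->
    I `<=` P \/ J `<=` P.

Definition J_prime (B : pzRingType) (P : ideal B) : Prop :=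
  prime_ideal P /\ jacobson_radical (ring_quot P) = [set 0].

Definition J_pm (B : pzRingType) : Prop :=
  forall P : ideal B, J_prime P ->
    exists! M : ideal B, maximal_ideal M /\ P `<=` M.

(** ** The J-spectrum *)

Record JSpec (B : pzRingType) := MkJSpec {
  JSpec_ideal :> ideal B;
  JSpecP : J_prime JSpec_ideal
}.

Lemma JSpec_ext (B : pzRingType) (P Q : JSpec B) :
  (P : ideal B) = (Q : ideal B) -> P = Q.
Proof.
case: P Q => [P jP] [Q jQ] /= PQ; subst Q.
by congr MkJSpec; exact: Prop_irrelevance.
Qed.

HB.instance Definition _ (B : pzRingType) := gen_eqMixin (JSpec B).
HB.instance Definition _ (B : pzRingType) := gen_choiceMixin (JSpec B).

Definition JSpec_D (B : pzRingType) (I : ideal B) : set (JSpec B) :=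
  [set P : JSpec B | ~ (I `<=` P)].

Definition JSpec_op (B : pzRingType) : set_system (JSpec B) :=
  [set U | exists I : ideal B, U = JSpec_D I].

Section JSpecTopology.
Variable B : pzRingType.

Let idealT : ideal B.
Proof. by exists setT. Defined.

Let ideal_cap (I J : ideal B) : ideal B.
Proof.
exists (I `&` J).
- by split; exact: ideal0.
- by move=> a b [? ?] [? ?]; split; exact: idealB.
- by move=> r a [? ?]; split; exact: idealMl.
- by move=> a r [? ?]; split; exact: idealMr.
Defined.

Let ideal_gen (S : set B) : ideal B.
Proof.
exists [set a | forall K : ideal B, S `<=` K -> (K : set B) a].
- by move=> K _; exact: ideal0.
- by move=> a b Sa Sb K SK; apply: idealB; [exact: Sa|exact: Sb].
- by move=> r a Sa K SK; apply: idealMl; exact: Sa.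
- by move=> a r Sa K SK; apply: idealMr; exact: Sa.
Defined.

Fact JSpec_opT : JSpec_op (setT : set (JSpec B)).
Proof.
exists idealT; apply/seteqP; split=> // P _ TP.
case: (JSpecP P) => -[/eqP PT _] _; apply: PT.
by apply/seteqP; split.
Qed.

Fact JSpec_opI : setI_closed (@JSpec_op B).
Proof.
move=> _ _ [I ->] [J ->]; exists (ideal_cap I J).
apply/seteqP; split=> P /=.
  move=> [IP JP] IJP; case: (JSpecP P) => -[_ /(_ I J)] + _; case=> //.
  by move=> a b Ia Jb; apply: IJP; split; [exact: idealMr|exact: idealMl].
by move=> IJP; split=> HP; apply: IJP => a [? ?]; exact: HP.
Qed.

Fact JSpec_op_bigU (I : Type) (f : I -> set (JSpec B)) :
  (forall i, JSpec_op (f i)) -> JSpec_op (\bigcup_i f i).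
Proof.
move=> opf; pose g i := sval (cid (opf i)).
have fE i : f i = JSpec_D (g i) by rewrite /g; case: cid.
exists (ideal_gen (\bigcup_i (g i : set B))); apply/seteqP; split=> P /=.
  move=> [i _]; rewrite fE /= => giP genP; apply: giP => a gia.
  by apply: genP => K; apply; exists i.
move=> genP; apply: contrapT => nP; apply: genP => a /(_ P); apply.
move=> b [i _ gib]; apply: contrapT => nPb; apply: nP; exists i => //.
by rewrite fE /= => /(_ _ gib).
Qed.

HB.instance Definition _ := isOpenTopological.Build (JSpec B)
  JSpec_opT JSpec_opI JSpec_op_bigU.

Lemma open_JSpecE (U : set (JSpec B)) :
  open U <-> exists I : ideal B, U = JSpec_D I.
Proof. by []. Qed.

End JSpecTopology.

(* A subset of the J-spectrum; as a type it is the library's [set_type], with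
   the subspace topology. *)
Definition Max (B : pzRingType) : set (JSpec B) :=
  [set P : JSpec B | maximal_ideal P].
Arguments Max B : clear implicits.

Definition retract_of (T : topologicalType) (S : set T) : Prop :=
  exists f : T -> S, continuous f /\ forall x : S, f (set_val x) = x.

(* [normal_space] is normality in the sense of separating disjoint closed sets
   by open sets, without any T1 hypothesis; the library's [normal_openP] says
   the same but needs a [realType] argument. *)
Lemma normal_space_openP (T : topologicalType) :
  normal_space T <->
  forall C D : set T, closed C -> closed D -> C `&` D = set0 ->
    exists U V, [/\ open U, open V, C `<=` U, D `<=` V & U `&` V = set0].
Proof.
split=> [nT C D clC clD CD0|H C clC W /set_nbhsP [U [oU CU UW]]].
  have : set_nbhs C (~` D).
    apply/set_nbhsP; exists (~` D); split => //; first exact: closed_openC.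
    exact/disjoints_subset.
  move=> /(nT _ clC) [W /set_nbhsP [U [oU CU UW]] WD].
  exists U, (~` closure W); split => //.
  - by apply: closed_openC; exact: closed_closure.
  - by apply/subsetCr.
  - apply/disjoints_subset; rewrite setCK.
    exact: (subset_trans UW (@subset_closure _ W)).
have CU0 : C `&` ~` U = set0 by apply/disjoints_subset; rewrite setCK.
have [V [V' [oV oV' CV UV' VV'0]]] := H _ _ clC (open_closedC oU) CU0.
exists V; first by apply/set_nbhsP; exists V; split.
have VV' : closure V `<=` ~` V'.
  rewrite [X in _ `<=` X](closure_id _).1; last exact: open_closedC.
  exact/closureS/disjoints_subset.
exact: (subset_trans VV' (subset_trans (subsetCl UV') UW)).
Qed.

(** ** Skew PBW extensions *)

(* [b] is indexed, so that distinct indices give distinct basis elements; the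
   left action of [R] on [A] is through [iota]. *)
Definition left_basis (R A : pzRingType) (iota : R -> A) (I : eqType)
    (b : I -> A) : Prop :=
  (forall a : A, exists (s : seq I) (c : I -> R),
     a = \sum_(i <- s) iota (c i) * b i) /\
  (forall (s : seq I) (c : I -> R), uniq s ->
     \sum_(i <- s) iota (c i) * b i = 0 -> forall i, i \in s -> c i = 0).

Definition monomial (A : pzRingType) (n : nat) (x : 'I_n -> A)
    (alpha : {ffun 'I_n -> nat}) : A :=
  \prod_(i < n) x i ^+ alpha i.

(* The ring [R] is regarded as a subring of [A] through [iota]. *)
Record skew_PBW_extension (R A : pzRingType) (iota : {rmorphism R -> A})
    (n : nat) (x : 'I_n -> A) : Prop := SkewPBWExtension {
  skew_PBW_inj : injective iota;
  skew_PBW_basis : left_basis iota (monomial x);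
  skew_PBW_coef : forall (i : 'I_n) (r : R), r != 0 ->
    exists2 c : R, c != 0 &
      exists s : R, x i * iota r - iota c * x i = iota s;
  skew_PBW_var : forall i j : 'I_n,
    exists2 d : R, d != 0 &
      exists (s : R) (t : 'I_n -> R),
        x j * x i - iota d * x i * x j
        = iota s + \sum_(k < n) iota (t k) * x k
}.

Definition skew_derivation (R : pzRingType) (sigma delta : R -> R) : Prop :=
  {morph delta : r s / r + s} /\
  forall r s, delta (r * s) = sigma r * delta s + delta r * s.

(* For a skew PBW extension such a family exists and is unique. *)
Definition associated_endomorphisms (R A : pzRingType)
    (iota : {rmorphism R -> A}) (n : nat) (x : 'I_n -> A)
    (sigma : 'I_n -> {rmorphism R -> R}) : Prop :=
  forall i : 'I_n, injective (sigma i) /\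
    exists2 delta : R -> R, skew_derivation (sigma i) delta &
      forall r : R, x i * iota r = iota (sigma i r) * x i + iota (delta r).

Definition sigma_exp (R : pzRingType) (n : nat)
    (sigma : 'I_n -> {rmorphism R -> R}) (alpha : {ffun 'I_n -> nat}) :
    R -> R :=
  \big[(fun f g : R -> R => f \o g)/id]_(i < n) iter (alpha i) (sigma i).

Definition Sigma_semicommutative (R : pzRingType) (n : nat)
    (sigma : 'I_n -> {rmorphism R -> R}) : Prop :=
  forall a b : R, a * b = 0 ->
    forall alpha : {ffun 'I_n -> nat}, alpha != [ffun=> 0%N] ->
      forall r : R, a * r * sigma_exp sigma alpha b = 0.

Definition reduced_ring (R : pzRingType) : Prop :=
  forall (a : R) (k : nat), a ^+ k = 0 -> a = 0.

(* Main.v *)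
From Pilot Require Import Defs.
From mathcomp Require Import all_boot all_order all_algebra.
From mathcomp Require Import generic_quotient.
From mathcomp Require Import all_classical all_reals all_analysis.

(** In any ring an open set of the J-spectrum that contains a J-prime ideal also
    contains the J-prime ideals below it. Two maximal ideals above the same
    J-prime ideal can therefore not be separated, and a continuous map to the
    maximal ideals that fixes them sends a J-prime ideal to every maximal ideal
    above it; hence each of normality and retractability implies J-pm
    ([normal_J_pm], [retract_J_pm]). Once the maximal ideal above each J-prime
    ideal is unique, normality makes the map to it continuous
    ([normal_retract]).

    The implication from J-pm to normality depends on the ring [A]. For every
    minimal prime ideal [p] of the reduced ring [R], the elements of [A] with
    all coefficients in [p] form an ideal [pA]. Semicommutativity makes [p]
    stable under the endomorphisms and the derivations, in both directions for
    the endomorphisms, so that leading terms multiply modulo [p]: the ring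
    [A / pA] is a domain with an additive degree. Such a ring has zero Jacobson
    radical as soon as there is a variable, because [1 - x f] has positive
    degree and cannot be invertible. Hence [pA] is J-prime
    ([compl_ideal_J_prime]).

    Suppose now that [A] is J-pm and let [M] and [N] be distinct maximal ideals.
    No [pA] lies in both, so no [p] does; the multiplicative set generated by
    the elements of [R] outside [M] or outside [N] then meets every minimal
    prime ideal, which forces it to contain [0]. Grouping the factors of such a
    vanishing product yields [a] outside [M] and [b] outside [N] such that every
    [pA] contains [a] or [b]; as the intersection of the [pA] is zero,
    [a A b = 0] ([J_pm_annihilator_separated]).

    Finally such annihilating pairs for distinct maximal ideals give annihilating
    pairs for disjoint closed sets, by two comaximality arguments that play the
    role of compactness ([separate_max_closed], [separate_closed]), and an
    annihilating pair yields disjoint open neighbourhoods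
    ([annihilator_separated_normal]).

    A minimal prime ideal of [R] is handled through its complement, a maximal
    multiplicative set. *)

Set Implicit Arguments.
Unset Strict Implicit.
Unset Printing Implicit Defensive.

Import Pilot.Defs GRing.Theory.

Local Open Scope classical_set_scope.
Local Open Scope ring_scope.
Local Open Scope quotient_scope.

(** * Maximal objects *)

(** Zorn's lemma above a given set. Chains are required to be nonempty, because
    the union of the empty chain need not have the property; in exchange they
    are only used through their being directed. *)
Lemma Zorn_above (T : Type) (P : set (set T)) (S : set T) :
  P S ->
  (forall F : set (set T), F `<=` P -> F !=set0 ->
     (forall X Y, F X -> F Y -> exists Z, [/\ F Z, X `<=` Z & Y `<=` Z]) ->
     P (\bigcup_(X in F) X)) ->
  exists X, [/\ P X, S `<=` X & forall Y, P Y -> X `<=` Y -> Y = X].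
Proof.
move=> PS Pchain.
have [F FP totF|A [PA Amax]] := @Zorn_bigcup T [set X | P (S `|` X)].
  have [[X FX]|F0] := pselect (F !=set0); last first.
    suff -> : F = set0 by rewrite /= bigcup_set0 setU0.
    by apply/seteqP; split=> // X FX; case: F0; exists X.
  rewrite /=; have -> : S `|` \bigcup_(X in F) X =
      \bigcup_(Z in [set S `|` X | X in F]) Z.
    apply/seteqP; split=> [a [Sa|[Y FY Ya]]|a [_ [Y FY <-]] [Sa|Ya]].
    - by exists (S `|` X); [exists X|left].
    - by exists (S `|` Y); [exists Y|right].
    - by left.
    - by right; exists Y.
  apply: Pchain => [_ [Y FY <-]||_ _ [Y FY <-] [Z FZ <-]].
  - exact: FP.
  - by exists (S `|` X); exists X.
  - have [YZ|ZY] := totF _ _ FY FZ.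
      by exists (S `|` Z); split=> //; [exists Z|exact: setUS].
    by exists (S `|` Y); split=> //; [exists Y|exact: setUS].
exists (S `|` A); split=> // Y PY SAY.
apply: contrapT => neY; apply: (Amax Y); last first.
  by rewrite /= setUidr // => a Sa; apply: SAY; left.
split=> [a Aa|YA]; first by apply: SAY; right.
by apply: neY; apply/seteqP; split=> // a Ya; right; exact: YA.
Qed.

(** * Ideals and J-prime ideals *)

Lemma exists_maximal_left_ideal (B : pzRingType) (L : set B) :
  left_ideal L -> ~ L 1 -> exists K, maximal_left_ideal K /\ L `<=` K.
Proof.
move=> lL L1.
have [//||K [[lK K1] LK Kmax]] :=
    @Zorn_above B [set X | left_ideal X /\ ~ X 1] L.
  move=> F FP [X0 FX0] dir; split; last by move=> [X /FP[_ X1] /X1].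
  split=> [|a b [X FX Xa] [Y FY Yb]|r a [X FX Xa]].
  - by exists X0 => //; have [[]] := FP _ FX0.
  - have [Z [FZ XZ YZ]] := dir _ _ FX FY; exists Z => //.
    by have [[_ ZB _] _] := FP _ FZ; apply: ZB; [exact: XZ|exact: YZ].
  - by exists X => //; have [[_ _ XM] _] := FP _ FX; exact: XM.
exists K; split=> //; split=> //; first by apply/eqP => KT; apply: K1; rewrite KT.
move=> K' lK' KK'; have [K'1|K'1] := pselect (K' 1); last by left; exact: Kmax.
right; apply/seteqP; split=> // a _; rewrite -(mulr1 a).
by case: lK' => _ _; apply.
Qed.

(** For a maximal left ideal [L], the left ideal of the [c] with [c * r] in [L]
    is again maximal, unless [r] lies in [L]. *)
Lemma jacobson_radicalMr (B : pzRingType) (a r : B) :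
  jacobson_radical B a -> jacobson_radical B (a * r).
Proof.
move=> Ja L maxL; have [[L0 LB LM] LT Lmax] := maxL.
pose K := [set c | L (c * r)].
have lK : left_ideal K.
  split=> [|c d Kc Kd|s c Kc]; rewrite /K/=; first by rewrite mul0r.
  - by rewrite mulrBl; exact: LB.
  - by rewrite -mulrA; exact: LM.
have [Lr|Lr] := pselect (L r); first exact: LM.
suff : K a by []; apply: (Ja K); split=> //.
  by apply/eqP => KT; apply: Lr; rewrite -(mul1r r) -[L _]/(K 1) KT.
move=> K' [K'0 K'B K'M] KK'; have [K'K|] := pselect (K' `<=` K).
  by left; apply/seteqP; split.
move=> /nonsubset[c [K'c Kc]]; right; apply/seteqP; split=> // d _.
(* [L + B c r] is the whole ring, hence contains [d * r]. *)
pose L' := [set e | exists l s, L l /\ e = l + s * (c * r)].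
have L'P : L' = L \/ L' = setT.
  apply: Lmax => [|e Le]; last by exists e, 0; rewrite mul0r addr0.
  split=> [|_ _ [l [s [Ll ->]]] [l' [s' [Ll' ->]]]|t _ [l [s [Ll ->]]]].
  - by exists 0, 0; rewrite mul0r addr0.
  - exists (l - l'), (s - s'); split; first exact: LB.
    by rewrite opprD addrACA mulrBl.
  - by exists (t * l), (t * s); split; [exact: LM|rewrite mulrDr mulrA].
have L'cr : L' (c * r) by exists 0, 1; rewrite mul1r add0r.
have [L'E|L'T] := L'P; first by case: Kc; rewrite /K/= -L'E.
have : L' (d * r) by rewrite L'T.
move=> [l [s [Ll dr]]].
have Ksc : K' (- (s * c)) by rewrite -sub0r; apply: K'B => //; exact: K'M.
have -> : d = d - s * c - - (s * c) by rewrite opprK subrK.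
by apply: K'B => //; apply: KK'; rewrite /K/= mulrBl dr -mulrA addrK.
Qed.

Section Ideals.
Variable B : pzRingType.
Implicit Types (I J M N P : ideal B) (L K : set B) (a b r : B).

Lemma ideal_eqT I : (I : set B) = setT <-> (I : set B) 1.
Proof.
split=> [->//|I1]; apply/seteqP; split=> // a _.
by rewrite -(mulr1 a); exact: idealMl.
Qed.

Lemma ideal_neqT I : (I : set B) != setT <-> ~ (I : set B) 1.
Proof.
by split=> [/eqP nT /ideal_eqT //|n1]; apply/eqP => /ideal_eqT.
Qed.

Lemma idealD I a b : (I : set B) a -> (I : set B) b -> (I : set B) (a + b).
Proof. by move=> Ia Ib; rewrite -(opprK b); apply: idealB => //; exact: idealN. Qed.

Lemma exists_maximal_ideal I :
  ~ (I : set B) 1 -> exists M, maximal_ideal M /\ I `<=` M.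
Proof.
move=> I1.
have [||X [[[M <-] M1] IM Mmax]] :=
    @Zorn_above B [set X | (exists I, (I : set B) = X) /\ ~ X 1] I.
- by split=> //; exists I.
- move=> F FP [X0 FX0] dir; split; last by move=> [X /FP[_ X1] /X1].
  unshelve eexists (@Ideal _ (\bigcup_(X in F) X) _ _ _ _) => //=.
  + by exists X0 => //; have [[K <-] _] := FP _ FX0; exact: ideal0.
  + move=> a b [X FX Xa] [Y FY Yb].
    have [Z [FZ XZ YZ]] := dir _ _ FX FY; exists Z => //.
    have [[K KZ] _] := FP _ FZ; rewrite -KZ; apply: idealB; rewrite KZ.
      exact: XZ.
    exact: YZ.
  + move=> r a [X FX Xa]; exists X => //.
    by have [[K KX] _] := FP _ FX; move: Xa; rewrite -KX => Xa; exact: idealMl.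
  + move=> a r [X FX Xa]; exists X => //.
    by have [[K KX] _] := FP _ FX; move: Xa; rewrite -KX => Xa; exact: idealMr.
exists M; split=> //; split; first exact/ideal_neqT.
move=> K MK; have [K1|K1] := pselect ((K : set B) 1).
  by right; exact/ideal_eqT.
by left; apply: ideal_ext; apply: Mmax => //; split=> //; exists K.
Qed.

(** The sum of [I] and [J] is an ideal which, if proper, would lie in a maximal
    ideal. *)
Lemma comaximal I J :
  (forall M, maximal_ideal M -> I `<=` M -> ~ J `<=` M) ->
  exists i j, [/\ (I : set B) i, (J : set B) j & i + j = 1].
Proof.
move=> noM.
unshelve epose (K := @Ideal _
  [set a | exists i j, [/\ (I : set B) i, (J : set B) j & i + j = a]] _ _ _ _).
- by exists 0, 0; split; [exact: ideal0|exact: ideal0|rewrite addr0].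
- move=> _ _ [i [j [Ii Jj <-]]] [k [l [Ik Jl <-]]].
  by exists (i - k), (j - l); split; [exact: idealB|exact: idealB|
    rewrite opprD addrACA].
- move=> r _ [i [j [Ii Jj <-]]].
  by exists (r * i), (r * j); split; [exact: idealMl|exact: idealMl|
    rewrite mulrDr].
- move=> _ r [i [j [Ii Jj <-]]].
  by exists (i * r), (j * r); split; [exact: idealMr|exact: idealMr|
    rewrite mulrDl].
have [//|K1] := pselect ((K : set B) 1).
have [M [maxM KM]] := exists_maximal_ideal K1.
exfalso; apply: (noM M maxM) => a ?; apply: KM.
  by exists a, 0; split=> //; [exact: ideal0|rewrite addr0].
by exists 0, a; split=> //; [exact: ideal0|rewrite add0r].
Qed.

Lemma maximal_ideal_eq M N :
  maximal_ideal M -> maximal_ideal N -> M `<=` N -> M = N.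
Proof. by move=> [_ Mmax] [/eqP NT _] MN; have [|/NT] := Mmax N MN. Qed.

Lemma maximal_ideal_comaximal M I : maximal_ideal M -> ~ I `<=` M ->
  exists i m, [/\ (I : set B) i, (M : set B) m & i + m = 1].
Proof.
move=> maxM IM; apply: comaximal => N maxN IN MN; apply: IM.
by rewrite (maximal_ideal_eq maxM maxN MN).
Qed.

Lemma maximal_ideal_prime M : maximal_ideal M -> prime_ideal M.
Proof.
move=> Mmax; split=> [|I J IJ]; first by case: Mmax.
apply: contrapT => /not_orP[IM JM].
have [i [m [Ii Mm im1]]] := maximal_ideal_comaximal Mmax IM.
have [j [m' [Jj Mm' jm1]]] := maximal_ideal_comaximal Mmax JM.
have [/ideal_neqT M1 _] := Mmax; apply: M1.
rewrite -(mulr1 1) -{1}im1 -jm1 mulrDl mulrDr -addrA.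
apply: idealD; first exact: IJ.
by apply: idealD; [exact: idealMl|exact: idealMr].
Qed.

(** If all [a * r * b] were in [P], so would be the product of the ideal [I] of
    the [c] with [c B b] in [P] and of the ideal [J] of the [d] with [I d] in
    [P]; these contain [a] and [b]. *)
Lemma prime_ideal_mulP P a b : prime_ideal P ->
  ~ (P : set B) a -> ~ (P : set B) b -> exists r, ~ (P : set B) (a * r * b).
Proof.
move=> [_ primeP] Pa Pb; apply: contrapT => /forallNP nP.
have {}nP r : (P : set B) (a * r * b) by apply: contrapT; exact: nP.
unshelve epose (I := @Ideal _
  [set c | forall r, (P : set B) (c * r * b)] _ _ _ _).
- by move=> r; rewrite !mul0r; exact: ideal0.
- by move=> c d Pc Pd r; rewrite !mulrBl; exact: idealB.
- by move=> s c Pc r; rewrite -!mulrA; apply: idealMl; rewrite mulrA.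
- by move=> c s Pc r; rewrite -(mulrA c s).
unshelve epose (J := @Ideal _
  [set d | forall c, (I : set B) c -> (P : set B) (c * d)] _ _ _ _).
- by move=> c _; rewrite mulr0; exact: ideal0.
- by move=> d e Jd Je c Ic; rewrite mulrBr; apply: idealB; [exact: Jd|exact: Je].
- by move=> s d Jd c Ic; rewrite mulrA; apply: Jd; exact: idealMr.
- by move=> d s Jd c Ic; rewrite mulrA; apply: idealMr; exact: Jd.
have [c d Ic Jd|IP|JP] := primeP I J; first exact: Jd.
- by apply: Pa; apply: IP => r; exact: nP.
- by apply: Pb; apply: JP => c /(_ 1); rewrite mulr1.
Qed.

(** The preimage of the radical of [B / M] is an ideal containing [M], so it is
    [M] or everything; the latter is excluded by a maximal left ideal of the
    nonzero ring [B / M]. *)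
Lemma maximal_ideal_J_prime M : maximal_ideal M -> J_prime M.
Proof.
move=> maxM; split; first exact: maximal_ideal_prime.
have [/ideal_neqT M1 Mmax] := maxM; set Q := ring_quot M.
apply/seteqP; split=> [q Jq|_ -> L [[L0 _ _] _ _]//].
unshelve epose (K := @Ideal _ [set a | jacobson_radical Q (\pi_Q a)] _ _ _ _).
- by move=> L [[L0 _ _] _ _]; rewrite raddf0.
- move=> a b Ja Jb L mL; have [[_ LB _] _ _] := mL.
  by rewrite raddfB; apply: LB; [exact: (Ja L)|exact: (Jb L)].
- move=> r a Ja L mL; have [[_ _ LM] _ _] := mL.
  by rewrite /= pi_quotM; apply: LM; exact: (Ja L).
- by move=> a r Ja; rewrite /= pi_quotM; exact: jacobson_radicalMr.
have [a Ma|KM|/ideal_eqT K1] := Mmax K.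
- by move=> L [[L0 _ _] _ _]; rewrite (pi_quot0 M a).2.
- have : (K : set B) (repr q) by rewrite /= reprK.
  by rewrite KM => Mq; rewrite -[q]reprK; exact/pi_quot0.
exfalso; have [L [mL _]] :
    exists L : set Q, maximal_left_ideal L /\ [set (0 : Q)] `<=` L.
  apply: exists_maximal_left_ideal.
    split=> //= [a b -> ->|r a ->]; first by rewrite subr0.
    by rewrite mulr0.
  by rewrite -pi_quot1 => /pi_quot0.
have [[_ _ LM] /eqP LT _] := mL; apply: LT; apply/seteqP; split=> // p _.
by rewrite -(mulr1 p); apply: LM; rewrite -pi_quot1; exact: K1.
Qed.

End Ideals.

(** * Normality, retractions and unique maximal ideals *)

Section Spectrum.
Variable B : pzRingType.
Implicit Types (I J M N : ideal B) (P Q : JSpec B) (C U : set (JSpec B)).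

Lemma JSpec_closedP C : closed C -> exists I, C = [set P : JSpec B | I `<=` P].
Proof.
move=> /closed_openC /open_JSpecE[I CI]; exists I.
apply/seteqP; split=> P; last first.
  by move=> IP; apply: contrapT => nC; have : (~` C) P by []; rewrite CI; apply.
move=> CP; apply: contrapT => IP.
by have : JSpec_D I P by []; rewrite -CI; apply.
Qed.

Lemma open_JSpec_D I : open (JSpec_D I).
Proof. by apply/open_JSpecE; exists I. Qed.

Lemma JSpec_neq1 P : ~ (P : set B) 1.
Proof. by have [[/ideal_neqT]] := JSpecP P. Qed.

Lemma JSpec_open_sub U P Q : open U -> P `<=` Q -> U Q -> U P.
Proof. by move=> /open_JSpecE[I ->] PQ IQ IP; apply: IQ => a /IP /PQ. Qed.

Lemma JSpec_max_over P : exists Q : Max B, P `<=` set_val Q.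
Proof.
have [M [maxM PM]] := exists_maximal_ideal (@JSpec_neq1 P).
pose Q := MkJSpec (maximal_ideal_J_prime maxM).
by exists (SigSub (mem_set (maxM : Max B Q))).
Qed.

Lemma JSpec_closed_max (Q : Max B) : closed [set set_val Q].
Proof.
rewrite -[X in closed X]setCK; apply: open_closedC.
apply/open_JSpecE; exists (set_val Q : JSpec B).
apply/seteqP; split=> P /=; last by move=> QP PQ; apply: QP; rewrite PQ.
move=> PQ QP; apply: PQ; apply: JSpec_ext.
have [_ maxQ] := set_valP Q; have [//|PT] := maxQ P QP.
by have [[/eqP]] := JSpecP P.
Qed.

Lemma J_pmP : J_pm B <->
  forall (P : JSpec B) (M N : Max B),
    P `<=` set_val M -> P `<=` set_val N -> M = N.
Proof.
split=> [pmB P M N PM PN|uniqB P JP].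
  have [M0 [_ uniqM0]] := pmB _ (JSpecP P).
  apply: val_inj; apply: JSpec_ext.
  rewrite -(uniqM0 (set_val M : JSpec B)); last by split=> //; exact: (set_valP M).
  by rewrite -(uniqM0 (set_val N : JSpec B)) //; split=> //; exact: (set_valP N).
have [M PM] := JSpec_max_over (MkJSpec JP).
exists (set_val M : JSpec B); split; first by split=> //; exact: (set_valP M).
move=> N [maxN PN].
pose N' := MkJSpec (maximal_ideal_J_prime maxN).
by rewrite (uniqB (MkJSpec JP) M (SigSub (mem_set (maxN : Max B N')))).
Qed.

(** Every open neighbourhood of a maximal ideal above [P] contains [P]. *)
Lemma normal_J_pm : normal_space (JSpec B) -> J_pm B.
Proof.
move=> /normal_space_openP nB; apply/J_pmP => P M N PM PN.
apply: contrapT => MN.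
have [|||U [V [oU oV MU NV UV]]] := nB [set set_val M] [set set_val N].
- exact: JSpec_closed_max.
- exact: JSpec_closed_max.
- apply/seteqP; split=> // Q [-> /= MNv]; exact/MN/val_inj.
suff : set0 P by []; rewrite -UV; split.
  by apply: (JSpec_open_sub oU PM); exact: MU.
by apply: (JSpec_open_sub oV PN); exact: NV.
Qed.

(** If [Q] is maximal above [P] and differs from [f P], then [f Q = Q] puts [Q]
    in the preimage of the complement of the closed point [f P]. That preimage
    is open, so it contains [P] as well, which is absurd. *)
Lemma retract_J_pm : retract_of (Max B) -> J_pm B.
Proof.
move=> [f [/continuousP cf fK]]; apply/J_pmP => P M N.
suff fP (Q : Max B) : P `<=` set_val Q -> Q = f P by move=> /fP -> /fP ->.
move=> PQ; apply: contrapT => neQ.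
have oU : open (set_val @^-1` (~` [set set_val (f P)]) : set (Max B)).
  exists (~` [set set_val (f P)]) => //.
  by apply: closed_openC; exact: JSpec_closed_max.
have := JSpec_open_sub (cf _ oU) PQ; rewrite /= fK; apply=> //.
by move=> /val_inj.
Qed.

(** The map sends [P] to the maximal ideal above it. For a neighbourhood [U] of
    [f P], separate [f P] from the complement of [U] by [V] and [W]: then [P] is
    in [V], and no [Q] in [V] can have [f Q] in [W]. *)
Lemma normal_retract : normal_space (JSpec B) -> retract_of (Max B).
Proof.
move=> nB; have /J_pmP uniqB := normal_J_pm nB.
have [f Pf] := choice JSpec_max_over.
exists f; split; last first.
  by move=> M; symmetry; apply: (uniqB (set_val M)) => //; exact: Pf.
apply/continuousP => _ [U oU <-]; rewrite openE => P /= UfP.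
move/normal_space_openP: nB.
move=> /(_ [set set_val (f P)] (~` U))[|||V [W [oV oW fPV CW VW]]].
- exact: JSpec_closed_max.
- exact: open_closedC.
- by apply/seteqP; split=> // Q [/= ->].
have VP : V P by apply: (JSpec_open_sub oV (Pf P)); exact: fPV.
rewrite /interior nbhsE /=; exists V; first by split.
move=> Q VQ /=; apply: contrapT => /CW WfQ.
suff : set0 Q by []; rewrite -VW; split=> //.
exact: (JSpec_open_sub oW (Pf Q)).
Qed.

(** A strengthening of the Hausdorff property of the maximal spectrum: the
    principal ideals of [a] and [b] define disjoint open sets around [M] and
    [N]. *)
Definition annihilator_separated :=
  forall M N, maximal_ideal M -> maximal_ideal N -> M <> N ->
    exists a b, [/\ ~ (M : set B) a, ~ (N : set B) b & forall r, a * r * b = 0].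

Section Separation.
Hypothesis sepB : annihilator_separated.

(** The elements [b] annihilated by some [a] outside [M] form an ideal [O]. By
    assumption a maximal ideal containing [O] is equal to [M], and [M] does not
    contain [J], so that [O] and [J] are comaximal. *)
Lemma separate_max_closed M J : maximal_ideal M -> ~ J `<=` M ->
  exists a b, [/\ ~ (M : set B) a, (J : set B) (1 - b) & forall r, a * r * b = 0].
Proof.
move=> maxM JM; have primeM := maximal_ideal_prime maxM.
unshelve epose (O := @Ideal _
  [set b | exists a, ~ (M : set B) a /\ forall r, a * r * b = 0] _ _ _ _).
- by exists 1; split=> [|r]; [exact/ideal_neqT/primeM.1|rewrite mulr0].
- move=> b c [a [Ma ab]] [d [Md dc]].
  have [s Ms] := prime_ideal_mulP primeM Ma Md.
  exists (a * s * d); split=> // r; rewrite mulrBr.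
  have -> : a * s * d * r * b = a * (s * d * r) * b by rewrite !mulrA.
  have -> : a * s * d * r * c = a * s * (d * r * c) by rewrite !mulrA.
  by rewrite ab dc mulr0 subrr.
- by move=> s b [a [Ma ab]]; exists a; split=> // r; rewrite mulrA -(mulrA a).
- by move=> b s [a [Ma ab]]; exists a; split=> // r; rewrite mulrA ab mul0r.
have [N maxN ON JN|b [j [[a [Ma ab]] Jj bj]]] := @comaximal _ O J.
  have [MN|a [b [Ma Nb ab]]] := sepB maxM maxN; first by apply: JM; rewrite MN.
  by apply: Nb; apply: ON; exists a.
by exists a, b; split=> //; rewrite -bj addrAC subrr add0r.
Qed.

(** The same argument with the roles exchanged: the elements [a] annihilating
    some [b] congruent to [1] modulo [J] form an ideal [L], which no maximal
    ideal above [I] contains. *)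
Lemma separate_closed I J :
  (forall M, maximal_ideal M -> I `<=` M -> ~ J `<=` M) ->
  exists a b, [/\ (I : set B) (1 - a), (J : set B) (1 - b)
    & forall r, a * r * b = 0].
Proof.
move=> IJ.
unshelve epose (L := @Ideal _
  [set a | exists b, (J : set B) (1 - b) /\ forall r, a * r * b = 0] _ _ _ _).
- by exists 1; split=> [|r]; [rewrite subrr; exact: ideal0|rewrite !mul0r].
- move=> a c [b [Jb ab]] [d [Jd cd]]; exists (b * d); split.
    have -> : 1 - b * d = (1 - b) + b * (1 - d).
      by rewrite mulrBr mulr1 addrA subrK.
    by apply: idealD => //; exact: idealMl.
  move=> r; rewrite !mulrBl.
  have -> : a * r * (b * d) = a * r * b * d by rewrite !mulrA.
  have -> : c * r * (b * d) = c * (r * b) * d by rewrite !mulrA.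
  by rewrite ab cd mul0r subrr.
- move=> s a [b [Jb ab]]; exists b; split=> // r.
  by rewrite -!mulrA (mulrA a) ab mulr0.
- by move=> a s [b [Jb ab]]; exists b; split=> // r; rewrite -(mulrA a).
have [M maxM LM IM|a [i [[b [Jb ab]] Ii ai]]] := @comaximal _ L I.
  have [a [b [Ma Jb ab]]] := separate_max_closed maxM (IJ _ maxM IM).
  by apply: Ma; apply: LM; exists b.
by exists a, b; split=> //; rewrite -ai addrAC subrr add0r.
Qed.

(** Closed sets are given by ideals [I] and [J]. The neighbourhoods are defined
    by the left annihilator [L] of [B b] and by the right annihilator [K] of
    [L]: these contain [a] and [b], and their product is zero. *)
Lemma annihilator_separated_normal : normal_space (JSpec B).
Proof.
apply/normal_space_openP => _ _ /JSpec_closedP[I ->] /JSpec_closedP[J ->] IJ0.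
have [M maxM IM JM|a [b [Ia Jb ab]]] := @separate_closed I J.
  suff : set0 (MkJSpec (maximal_ideal_J_prime maxM)) by [].
  by rewrite -IJ0; split.
unshelve epose (L := @Ideal _ [set c | forall r, c * r * b = 0] _ _ _ _).
- by move=> r; rewrite !mul0r.
- by move=> c d cb db r; rewrite !mulrBl cb db subrr.
- by move=> s c cb r; rewrite -!mulrA (mulrA c) cb mulr0.
- by move=> c s cb r; rewrite -(mulrA c).
unshelve epose (K := @Ideal _
  [set d | forall c, (L : set B) c -> c * d = 0] _ _ _ _).
- by move=> c _; rewrite mulr0.
- by move=> c d Kc Kd e Le; rewrite mulrBr Kc // Kd // subrr.
- by move=> s d Kd c Lc; rewrite mulrA; apply: Kd; exact: idealMr.
- by move=> d s Kd c Lc; rewrite mulrA Kd // mul0r.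
exists (JSpec_D L), (JSpec_D K); split.
- exact: open_JSpec_D.
- exact: open_JSpec_D.
- move=> P IP LP; apply: (@JSpec_neq1 P).
  by rewrite -(subrK a 1); apply: idealD; [exact: IP|exact: LP].
- move=> P JP KP; apply: (@JSpec_neq1 P).
  rewrite -(subrK b 1); apply: idealD; first exact: JP.
  by apply: KP => c /(_ 1); rewrite mulr1.
apply/seteqP; split=> // P [LP KP].
have [[_ primeP] _] := JSpecP P.
have [c d Lc Kd|//|//] := primeP L K.
by rewrite Kd //; exact: ideal0.
Qed.

End Separation.

End Spectrum.

(** * Maximal multiplicative sets of a reduced ring *)

Definition multiplicative_set (R : pzRingType) (T : set R) : Prop :=
  [/\ T 1, forall a b, T a -> T b -> T (a * b) & ~ T 0].

Definition maximal_multiplicative_set (R : pzRingType) (T : set R) : Prop :=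
  multiplicative_set T /\
  forall U, multiplicative_set U -> T `<=` U -> U = T.

Lemma exists_maximal_multiplicative_set (R : pzRingType) (S : set R) :
  multiplicative_set S ->
  exists T, maximal_multiplicative_set T /\ S `<=` T.
Proof.
move=> mS; have [//||T [mT ST Tmax]] := @Zorn_above R (@multiplicative_set R) S.
  move=> F FP [X0 FX0] dir; split; last by move=> [X /FP[_ _ X0'] /X0'].
  - by exists X0 => //; have [] := FP _ FX0.
  - move=> a b [X FX Xa] [Y FY Yb].
    have [Z [FZ XZ YZ]] := dir _ _ FX FY; exists Z => //.
    by have [_ ZM _] := FP _ FZ; apply: ZM; [exact: XZ|exact: YZ].
by exists T.
Qed.

Section Reduced.
Variable R : pzRingType.
Hypothesis R_reduced : reduced_ring R.
Implicit Types (a b r s t : R).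

Lemma reduced_mul0C a b : a * b = 0 -> b * a = 0.
Proof.
move=> ab; apply: (R_reduced (k := 2)).
by rewrite expr2 mulrA -(mulrA b) ab mulr0 mul0r.
Qed.

Lemma reduced_mul0_insert a b r : a * b = 0 -> a * r * b = 0.
Proof.
move=> /reduced_mul0C ba; apply: (R_reduced (k := 2)).
by rewrite expr2 -!mulrA (mulrA b) ba mul0r !mulr0.
Qed.

Variable T : set R.
Hypothesis maxT : maximal_multiplicative_set T.

(** So the complement of [T] consists of the [r] killed by an element of [T],
    as for a minimal prime ideal. If [r] were not killed by any, the elements
    whose right annihilator is contained in that of some [t * r], with [t] in
    [T], would form a multiplicative set strictly larger than [T]. In a reduced
    ring the factors of a vanishing product can be permuted and repeated at
    will, which is what makes this set closed under products. *)
Lemma maximal_multiplicative_annihilator r :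
  ~ T r -> exists2 t, T t & t * r = 0.
Proof.
have [[T1 TM T0] Tmax] := maxT.
move=> Tr; apply: contrapT => noann; apply: Tr.
pose U := [set y | exists2 t, T t & forall z, y * z = 0 -> t * r * z = 0].
suff <- : U = T by exists 1 => // z rz; rewrite mul1r.
apply: Tmax => [|t Tt]; last by exists t => // z; exact: reduced_mul0_insert.
split.
- by exists 1 => // z; rewrite mul1r => ->; rewrite mulr0.
- move=> y1 y2 [t1 Tt1 y1P] [t2 Tt2 y2P]; exists (t1 * t2); first exact: TM.
  move=> z; rewrite -mulrA => /y1P.
  (* [y2] is moved to the front, where [y2P] replaces it by [t2 * r]. *)
  move=> /reduced_mul0C; rewrite -mulrA => /y2P; rewrite !mulrA => t2rzt1r.
  apply: (R_reduced (k := 2)); rewrite expr2.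
  have := reduced_mul0_insert t2 t2rzt1r => E.
  have -> : t1 * t2 * r * z * (t1 * t2 * r * z) =
      t1 * (t2 * r * z * t1 * t2 * r) * z.
    by rewrite !mulrA.
  by rewrite E mulr0 mul0r.
- move=> [t Tt /(_ 1)]; rewrite mul0r mulr1 => /(_ erefl) tr.
  by apply: noann; exists t.
Qed.

Lemma maximal_multiplicativeM r s : T (r * s) <-> T r /\ T s.
Proof.
have [[T1 TM T0] Tmax] := maxT.
split=> [Trs|[]]; last exact: TM.
split; apply: contrapT => /maximal_multiplicative_annihilator[t Tt tr]; apply: T0.
  by rewrite -(mul0r s) -tr -mulrA; exact: TM.
rewrite -(reduced_mul0_insert r tr) -mulrA; exact: TM.
Qed.

Lemma maximal_multiplicative_complB r s : ~ T r -> ~ T s -> ~ T (r - s).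
Proof.
have [[T1 TM T0] Tmax] := maxT.
move=> /maximal_multiplicative_annihilator[t Tt tr].
move=> /maximal_multiplicative_annihilator[u Tu us] Trs; apply: T0.
have <- : t * u * (r - s) = 0.
  by rewrite mulrBr reduced_mul0_insert// -mulrA us mulr0 subrr.
exact: TM (TM _ _ Tt Tu) Trs.
Qed.

Lemma maximal_multiplicative_complD r s : ~ T r -> ~ T s -> ~ T (r + s).
Proof.
have [[T1 TM T0] Tmax] := maxT.
move=> Tr Ts; rewrite -(opprK s); apply: maximal_multiplicative_complB => //.
by rewrite -sub0r; exact: maximal_multiplicative_complB.
Qed.

Lemma maximal_multiplicative_mem_addr r s : ~ T s -> T (r + s) <-> T r.
Proof.
move=> Ts; split=> [Trs|Tr]; apply: contrapT => nT.
  exact: (maximal_multiplicative_complD nT Ts).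
by have := maximal_multiplicative_complB nT Ts; rewrite addrK.
Qed.

Lemma maximal_multiplicative_compl_sum (I : Type) (s : seq I) (P : pred I)
    (F : I -> R) :
  (forall i, P i -> ~ T (F i)) -> ~ T (\sum_(i <- s | P i) F i).
Proof.
have [[T1 TM T0] Tmax] := maxT.
by move=> TF; elim/big_ind: _ => //; exact: maximal_multiplicative_complD.
Qed.

(** The prime ideal complementary to [T] is its own preimage under a compatible
    injective endomorphism, and is stable under the derivations of the latter. *)
Section Twist.
Variables (f : {rmorphism R -> R}) (d : R -> R).
Hypothesis f_inj : injective f.
Hypothesis f_compatible : forall a b, a * b = 0 -> a * f b = 0.
Hypothesis dP : skew_derivation f d.

Lemma maximal_multiplicative_endo r : T (f r) <-> T r.
Proof.
have [[T1 TM T0] Tmax] := maxT.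
split=> Tr; apply: contrapT => /maximal_multiplicative_annihilator[t Tt tr];
  apply: T0.
  by rewrite -(f_compatible tr); exact: TM.
suff <- : t * r = 0 by exact: TM.
apply: reduced_mul0C; apply: f_inj; rewrite rmorphM rmorph0.
by apply: f_compatible; exact: reduced_mul0C.
Qed.

Lemma maximal_multiplicative_derivation r : ~ T r -> ~ T (d r).
Proof.
have [[T1 TM T0] Tmax] := maxT.
have [dD dM] := dP.
move=> /maximal_multiplicative_annihilator[t Tt tr].
have d0 : d 0 = 0 by apply: (addrI (d 0)); rewrite -dD !addr0.
have : f t * d r * t = 0.
  have := dM t r; rewrite tr d0 => /(congr1 ( *%R^~ t)).
  by rewrite mul0r mulrDl -(mulrA (d t)) (reduced_mul0C tr) mulr0 addr0.
move=> E Tdr; apply: T0; rewrite -E; apply/(TM _ _ _ Tt)/(TM _ _ _ Tdr).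
exact/maximal_multiplicative_endo.
Qed.

End Twist.
End Reduced.

(** A nonzero [r] has no vanishing power, so its powers lie in a maximal
    multiplicative set. *)
Lemma reduced_maximal_multiplicative_cap (R : pzRingType) (r : R) :
  reduced_ring R ->
  (forall T, maximal_multiplicative_set T -> ~ T r) -> r = 0.
Proof.
move=> R_reduced noT; apply: contrapT => r0.
have [|T [maxT ST]] :=
    @exists_maximal_multiplicative_set R [set r ^+ k | k in setT].
  split=> [|_ _ [k _ <-] [l _ <-]|[k _ /R_reduced //]]; first by exists 0%N.
  by exists (k + l)%N => //; rewrite exprD.
by apply: (noT T maxT); apply: ST; exists 1%N.
Qed.

(** * Exponents and the degree-lexicographic order *)

Section Deglex.
Variable n : nat.
Local Notation exponent := {ffun 'I_n -> nat}.
Implicit Types (a b c : exponent) (i j : 'I_n).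

Definition unit_exponent i : exponent := [ffun j => (j == i) : nat].

Definition degree a : nat := (\sum_i a i)%N.

(** Prepending the total degree to the exponents turns the lexicographic order
    into the degree-lexicographic one. *)
Definition deglex a : n.+1.-tuplelexi nat :=
  [tuple oapp a (degree a) (unlift ord0 i) | i < n.+1].

Lemma degreeD a b : degree (a + b) = (degree a + degree b)%N.
Proof. by rewrite /degree -big_split /=; apply: eq_bigr => i _; rewrite ffunE. Qed.

Lemma degree_unit i : degree (unit_exponent i) = 1%N.
Proof.
rewrite /degree (bigD1 i) //= big1 ?ffunE ?eqxx // => j /negbTE ji.
by rewrite ffunE ji.
Qed.

Lemma deglex_inj : injective deglex.
Proof.
move=> a b ab; apply/ffunP => i.
have := congr1 (fun t : n.+1.-tuple nat => tnth t (lift ord0 i)) ab.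
by rewrite !tnth_mktuple liftK.
Qed.

Lemma deglex_ltD c a b :
  (deglex a < deglex b)%O -> (deglex (a + c) < deglex (b + c))%O.
Proof.
have addE k : tnth (deglex (a + c)) k = (tnth (deglex a) k + tnth (deglex c) k)%N.
  by rewrite !tnth_mktuple; case: unlift => [j|] /=; [rewrite ffunE|exact: degreeD].
have addE' k : tnth (deglex (b + c)) k = (tnth (deglex b) k + tnth (deglex c) k)%N.
  by rewrite !tnth_mktuple; case: unlift => [j|] /=; [rewrite ffunE|exact: degreeD].
move=> /Order.TupleLexiOrder.ltxi_tuplePlt[k eqk ltk].
apply/Order.TupleLexiOrder.ltxi_tuplePlt; exists k.
  by move=> l lk; rewrite addE addE' eqk.
by rewrite addE addE' ltEnat /= ltn_add2r.
Qed.

Lemma deglex_leD c a b :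
  (deglex a <= deglex b)%O -> (deglex (a + c) <= deglex (b + c))%O.
Proof.
rewrite Order.POrderTheory.le_eqVlt => /orP[/eqP/deglex_inj ->//|/(deglex_ltD c)].
exact: Order.POrderTheory.ltW.
Qed.

Lemma deglex_lt_degree a b : (degree a < degree b)%N -> (deglex a < deglex b)%O.
Proof.
move=> ab; apply/Order.TupleLexiOrder.ltxi_tuplePlt; exists ord0 => //.
by rewrite !tnth_mktuple unlift_none.
Qed.

Lemma deglex_max (s : seq exponent) (P : exponent -> Prop) c :
  c \in s -> P c ->
  exists2 a, P a & forall b, b \in s -> P b -> (deglex b <= deglex a)%O.
Proof.
elim: s c => [//|d s IHs] c; rewrite inE => cs Pc.
have [[e es Pe]|noP] := pselect (exists2 e, e \in s & P e).
  have [a Pa amax] := IHs e es Pe.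
  have [Pd|Pd] := pselect (P d); last first.
    by exists a => // b; rewrite inE => /orP[/eqP ->|/amax].
  case: (Order.TotalTheory.leP (deglex d) (deglex a)) => da.
    by exists a => // b; rewrite inE => /orP[/eqP ->|/amax].
  exists d => // b; rewrite inE => /orP[/eqP ->//|bs Pb].
  exact: Order.POrderTheory.le_trans (amax b bs Pb) (Order.POrderTheory.ltW da).
exists c => // b; rewrite inE => /orP[/eqP bd|bs] Pb; last by case: noP; exists b.
case/orP: cs => [/eqP ->|cs]; first by rewrite bd.
by case: noP; exists c.
Qed.

End Deglex.

(** * Coordinates of a free left module *)

(** The span in a left basis is given by lists with possible repetitions and by
    coefficient functions that are arbitrary outside the list; normalising both
    and comparing two expansions on the union of their supports gives a
    coordinate function. *)
Lemma left_basis_coordinates (R A : pzRingType) (iota : {rmorphism R -> A})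
    (I : eqType) (b : I -> A) : left_basis iota b ->
  exists coef : A -> I -> R,
    [/\ forall a a' i, coef (a + a') i = coef a i + coef a' i,
        forall r a i, coef (iota r * a) i = r * coef a i,
        forall i j, coef (b i) j = (i == j)%:R
      & forall a, exists2 s, uniq s & a = \sum_(i <- s) iota (coef a i) * b i].
Proof.
move=> [gen indep].
have repr a : exists c : I -> R, exists s : seq I,
    [/\ uniq s, forall i, i \notin s -> c i = 0
      & a = \sum_(i <- s) iota (c i) * b i].
  have [s [c ->]] := gen a.
  exists (fun i => c i *+ count_mem i s), (undup s); split.
  - exact: undup_uniq.
  - by move=> i; rewrite mem_undup => /count_memPn ->; rewrite mulr0n.
  rewrite -big_undup_iterop_count /=; apply: eq_bigr => i _.
  by rewrite rmorphMn /= mulrnAl.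
have widen (u v : seq I) (c : I -> R) : uniq u -> uniq v -> {subset v <= u} ->
    (forall i, i \notin v -> c i = 0) ->
    \sum_(i <- v) iota (c i) * b i = \sum_(i <- u) iota (c i) * b i.
  move=> uu uv vu cv.
  rewrite [RHS](bigID [in v]) /= [X in _ + X]big1 => [|j /cv ->]; last first.
    by rewrite rmorph0 mul0r.
  rewrite addr0 -[RHS]big_filter; apply: perm_big.
  apply: uniq_perm => //; first by rewrite filter_uniq.
  move=> j; rewrite mem_filter.
  by case vj: (j \in v) => //=; rewrite vu.
have [coef coefP] := choice repr.
have common a a' : exists u : seq I,
    [/\ uniq u, a = \sum_(i <- u) iota (coef a i) * b i,
     a' = \sum_(i <- u) iota (coef a' i) * b i,
     forall i, i \notin u -> coef a i = 0 & forall i, i \notin u -> coef a' i = 0].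
  have [s [us cs aE]] := coefP a; have [t [ut ct aE']] := coefP a'.
  have uu : uniq (undup (s ++ t)) by exact: undup_uniq.
  exists (undup (s ++ t)); split=> //.
  - by rewrite -(widen _ s) // => i; rewrite mem_undup mem_cat => ->.
  - by rewrite -(widen _ t) // => i; rewrite mem_undup mem_cat => ->; rewrite orbT.
  - by move=> i; rewrite mem_undup mem_cat negb_or => /andP[/cs].
  - by move=> i; rewrite mem_undup mem_cat negb_or => /andP[_ /ct].
have coef_unique a (s : seq I) (c : I -> R) : uniq s ->
    (forall i, i \notin s -> c i = 0) -> a = \sum_(i <- s) iota (c i) * b i ->
    coef a =1 c.
  move=> us cs aE i; have [t [ut ct aE']] := coefP a.
  have uu : uniq (undup (s ++ t)) by exact: undup_uniq.
  have [iu|] := boolP (i \in undup (s ++ t)); last first.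
    by rewrite mem_undup mem_cat negb_or => /andP[/cs -> /ct ->].
  apply/eqP; rewrite -subr_eq0; apply/eqP.
  apply: (indep _ (fun i => coef a i - c i) uu) iu.
  under eq_bigr do rewrite rmorphB mulrBl.
  rewrite sumrB -(widen (undup (s ++ t)) t (coef a)) //; last first.
    by move=> j; rewrite mem_undup mem_cat => ->; rewrite orbT.
  rewrite -(widen (undup (s ++ t)) s c) -?aE -?aE' ?subrr // => j.
  by rewrite mem_undup mem_cat => ->.
exists coef; split.
- move=> a a'; have [u [uu aE aE' au au']] := common a a'.
  apply: (coef_unique _ u) => // [i iu|]; first by rewrite au // au' // addr0.
  under eq_bigr do rewrite rmorphD mulrDl.
  by rewrite big_split /= -aE -aE'.
- move=> r a; have [s [us cs aE]] := coefP a.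
  apply: (coef_unique _ s) => // [i /cs ->|]; first by rewrite mulr0.
  under eq_bigr do rewrite rmorphM -mulrA.
  by rewrite -mulr_sumr -aE.
- move=> i j; rewrite (coef_unique _ [:: i] (fun j => (i == j)%:R)) //.
    by move=> k; rewrite inE eq_sym => /negbTE ->.
  by rewrite big_seq1 eqxx rmorph1 mul1r.
- by move=> a; have [s [us _ aE]] := coefP a; exists s.
Qed.

(** * Leading terms modulo a minimal prime ideal *)

Section SkewPBW.
Variables (R A : pzRingType) (iota : {rmorphism R -> A}) (n : nat).
Variables (x : 'I_n -> A) (sigma : 'I_n -> {rmorphism R -> R}).
Variable delta : 'I_n -> R -> R.
Hypothesis A_skew_PBW : skew_PBW_extension iota x.
Hypothesis sigma_inj : forall i, injective (sigma i).
Hypothesis deltaP : forall i, skew_derivation (sigma i) (delta i).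
Hypothesis commuteP : forall i r,
  x i * iota r = iota (sigma i r) * x i + iota (delta i r).
Hypothesis sigma_compatible : forall i a b, a * b = 0 -> a * sigma i b = 0.
Hypothesis R_reduced : reduced_ring R.

Local Notation exponent := {ffun 'I_n -> nat}.
Local Notation X := (monomial x).
Local Notation e := (@unit_exponent n).

Variable coef : A -> exponent -> R.
Hypothesis coefD : forall f g c, coef (f + g) c = coef f c + coef g c.
Hypothesis coefZ : forall r f c, coef (iota r * f) c = r * coef f c.
Hypothesis coefX : forall a c, coef (X a) c = (a == c)%:R.
Hypothesis coef_span : forall f,
  exists2 s, uniq s & f = \sum_(a <- s) iota (coef f a) * X a.

Variable T : set R.
Hypothesis maxT : maximal_multiplicative_set T.

Implicit Types (a b c : exponent) (f g h : A) (r : R) (i j k : 'I_n).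

Let T1 : T 1. Proof. by have [[]] := maxT. Qed.
Let TM r1 r2 : T r1 -> T r2 -> T (r1 * r2).
Proof. by have [[_ + _] _] := maxT; apply. Qed.
Let T0 : ~ T 0. Proof. by have [[]] := maxT. Qed.

Let complMr r1 r2 : ~ T r1 -> ~ T (r1 * r2).
Proof. by move=> Tr /(maximal_multiplicativeM R_reduced maxT)[]. Qed.

Let complMl r1 r2 : ~ T r2 -> ~ T (r1 * r2).
Proof. by move=> Tr /(maximal_multiplicativeM R_reduced maxT)[]. Qed.

Let sigmaT i r : T (sigma i r) <-> T r.
Proof.
exact: (maximal_multiplicative_endo R_reduced maxT (@sigma_inj i)
  (@sigma_compatible i)).
Qed.

Let deltaT i r : ~ T r -> ~ T (delta i r).
Proof.
exact: (maximal_multiplicative_derivation R_reduced maxT (@sigma_inj i)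
  (@sigma_compatible i) (deltaP i)).
Qed.

Lemma coef0 c : coef 0 c = 0.
Proof. by rewrite -(mul0r 0) -{1}(rmorph0 iota) coefZ mul0r. Qed.

Lemma coefN f c : coef (- f) c = - coef f c.
Proof. by apply/eqP; rewrite -addr_eq0 -coefD addNr coef0. Qed.

Lemma coefB f g c : coef (f - g) c = coef f c - coef g c.
Proof. by rewrite coefD coefN. Qed.

Lemma coef_sum (I : Type) (s : seq I) (F : I -> A) c :
  coef (\sum_(i <- s) F i) c = \sum_(i <- s) coef (F i) c.
Proof.
by elim: s => [|i s IHs]; rewrite ?big_nil ?big_cons ?coef0 // coefD IHs.
Qed.

Lemma coef_outside f s c :
  f = \sum_(a <- s) iota (coef f a) * X a -> c \notin s -> coef f c = 0.
Proof.
move=> fE cs; rewrite fE coef_sum big_seq big1 // => a sa.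
rewrite coefZ coefX; case: eqP => [ac|_]; last by rewrite mulr0.
by rewrite -ac sa in cs.
Qed.

Lemma coef_mul f g s c : f = \sum_(a <- s) iota (coef f a) * X a ->
  coef (f * g) c = \sum_(a <- s) coef f a * coef (X a * g) c.
Proof.
move=> fE; rewrite {1}fE mulr_suml coef_sum.
by apply: eq_bigr => a _; rewrite -mulrA coefZ.
Qed.

Let delta0 i : delta i 0 = 0.
Proof.
by have [dD _] := deltaP i; apply: (addrI (delta i 0)); rewrite -dD !addr0.
Qed.

Lemma coef_var_mul i f s c : f = \sum_(a <- s) iota (coef f a) * X a ->
  coef (x i * f) c = \sum_(a <- s)
    (sigma i (coef f a) * coef (x i * X a) c + delta i (coef f a) * (a == c)%:R).
Proof.
move=> fE; rewrite {1}fE mulr_sumr coef_sum; apply: eq_bigr => a _.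
by rewrite mulrA commuteP mulrDl coefD -mulrA !coefZ coefX.
Qed.

Lemma monomial0 : X 0 = 1.
Proof. by rewrite /monomial big1 // => i _; rewrite ffunE expr0. Qed.

Lemma monomial_cons i a : (forall j, (j < i)%N -> a j = 0%N) ->
  X (e i + a) = x i * X a.
Proof.
move=> a0; rewrite /monomial -[index_enum _]enumT.
have : sorted ltn (map val (enum 'I_n)) by rewrite val_enum_ord iota_ltn_sorted.
have : i \in enum 'I_n by rewrite mem_enum.
elim: (enum 'I_n) => // j s IHs; rewrite inE !big_cons /= => ijs js.
have ajs k : k \in s -> (j < k)%N.
  move=> ks; move: js; rewrite (path_sortedE ltn_trans) => /andP[/allP + _].
  by apply; apply: map_f.
have [ji|/= is_] := eqVneq i j.
  rewrite -ji !ffunE eqxx exprD expr1 -mulrA; congr (_ * (_ * _)).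
  apply: eq_big_seq => k /ajs; rewrite -ji !ffunE => ik.
  by rewrite -val_eqE /= gtn_eqF.
rewrite (negbTE is_) /= in ijs.
rewrite !ffunE [j == i]eq_sym (negbTE is_) /= (a0 j (ajs _ ijs)) expr0 !mul1r.
by apply: IHs => //; exact: path_sorted js.
Qed.

Lemma monomial_unit i : X (e i) = x i.
Proof.
by rewrite -[e i]addr0 monomial_cons ?monomial0 ?mulr1 // => j; rewrite ffunE.
Qed.

(** Splitting off the smallest variable that occurs corresponds, by
    [monomial_cons], to an exact factorization of the monomial; this supports
    inductions on the degree. *)
Lemma exponent_split a : a = 0 \/
  exists j b, a = e j + b /\ forall k, (k < j)%N -> b k = 0%N.
Proof.
have [/forallP a0|/forallPn[j0 aj0]] := boolP [forall j, a j == 0%N].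
  by left; apply/ffunP => j; rewrite ffunE; exact/eqP.
case: (@arg_minnP _ j0 (fun j => a j != 0%N) val aj0) => j aj jmin.
right; exists j, [ffun k => (a k - (k == j))%N]; split.
  apply/ffunP => k; rewrite !ffunE; case: eqP => [->|_] /=.
    by case: (a j) aj => // m _; rewrite subn1.
  by rewrite subn0.
move=> k kj; rewrite ffunE; apply/eqP; rewrite subn_eq0.
have [->|/jmin] := eqVneq (a k) 0%N; first by [].
by rewrite leqNgt kj.
Qed.

Definition degree_le (m : nat) f := forall c, (m < degree c)%N -> coef f c = 0.

Lemma degree_leD m f g : degree_le m f -> degree_le m g -> degree_le m (f + g).
Proof. by move=> fm gm c mc; rewrite coefD fm // gm // addr0. Qed.

Lemma degree_leZ m r f : degree_le m f -> degree_le m (iota r * f).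
Proof. by move=> fm c mc; rewrite coefZ fm // mulr0. Qed.

Lemma degree_le_sum m (I : Type) (s : seq I) (F : I -> A) :
  (forall l, degree_le m (F l)) -> degree_le m (\sum_(l <- s) F l).
Proof. by move=> Fm c mc; rewrite coef_sum big1 // => l _; exact: Fm. Qed.

Lemma degree_leX a m : (degree a <= m)%N -> degree_le m (X a).
Proof.
move=> am c mc; rewrite coefX; case: eqP => // ac.
by move: mc; rewrite -ac ltnNge am.
Qed.

Lemma linear_degree_le r (t : 'I_n -> R) :
  degree_le 1 (iota r + \sum_(k < n) iota (t k) * x k).
Proof.
apply: degree_leD.
  rewrite -(mulr1 (iota r)) -monomial0; apply/degree_leZ/degree_leX.
  by rewrite /degree big1 // => i _; rewrite ffunE.
apply: degree_le_sum => k; rewrite -monomial_unit; apply/degree_leZ/degree_leX.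
by rewrite degree_unit.
Qed.

(** Applying the rules for [x j * x i] and for [x i * x j] in turn expresses
    the basis element [x i * x j] by itself up to linear terms, so that the
    product of the two constants is [1]; in particular they lie outside the
    prime ideal. *)
Lemma commutation_coef i j : (i < j)%N -> exists d r (t : 'I_n -> R),
  T d /\ x j * x i =
    iota d * (x i * x j) + (iota r + \sum_(k < n) iota (t k) * x k).
Proof.
move=> ij.
have [d _ [r [t E]]] := skew_PBW_var A_skew_PBW i j.
have [d' _ [r' [t' E']]] := skew_PBW_var A_skew_PBW j i.
move/eqP: E; rewrite subr_eq -mulrA addrC => /eqP E.
move/eqP: E'; rewrite subr_eq -mulrA addrC => /eqP E'.
exists d, r, t; split=> //.
suff d'd : d' * d = 1.
  have : T (d' * d) by rewrite d'd.
  by move=> /(maximal_multiplicativeM R_reduced maxT)[].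
have XE : X (e i + e j) = x i * x j.
  rewrite monomial_cons ?monomial_unit // => k ki.
  by rewrite ffunE; case: eqP ki => // ->; rewrite ltnNge ltnW.
move: (congr1 (fun f => coef f (e i + e j)) E').
have deg2 : (1 < degree (e i + e j)%R)%N by rewrite degreeD !degree_unit.
rewrite E mulrDr !mulrA -rmorphM -mulrA -XE !coefD !coefZ coefX eqxx mulr1.
rewrite -!coefD (linear_degree_le r' t' deg2) (linear_degree_le r t deg2).
by rewrite mulr0 !addr0.
Qed.

(** Up to terms of lower degree, multiplying a monomial by a variable only
    raises an exponent, at the cost of a constant in [T]. When [x i] is not
    already in front, it is commuted with the first variable [x j] of the
    monomial; all terms that appear are products of a variable with elements of
    smaller degree, and the degree of such products is controlled by the
    induction hypothesis ([up]). *)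
Lemma straightening a i :
  exists2 u, T u & degree_le (degree a) (x i * X a - iota u * X (e i + a)).
Proof.
move: i; have [m] := ubnP (degree a); elim: m a => // m IHm a am.
have up k f p : (p < m)%N -> degree_le p f -> degree_le p.+1 (x k * f).
  move=> pm fp c pc; have [s _ fE] := coef_span f.
  rewrite (coef_var_mul _ _ fE) big1 // => b _.
  have [bp|/fp ->] := leqP (degree b) p; last first.
    by rewrite rmorph0 delta0 !mul0r addr0.
  have bc : (degree b < degree c)%N by apply: leq_ltn_trans bp (ltnW pc).
  have [u _ /(_ c bc)] := IHm b (leq_ltn_trans bp pm) k.
  rewrite coefB coefZ coefX.
  have [kbc _|_] := eqVneq (e k + b) c.
    by move: pc; rewrite -kbc degreeD degree_unit add1n ltnS ltnNge bp.
  have [bcE|_] := eqVneq b c; first by rewrite bcE ltnn in bc.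
  by rewrite mulr0 subr0 => ->; rewrite !mulr0 addr0.
move=> i; have straight : (forall j, (j < i)%N -> a j = 0%N) ->
    exists2 u, T u & degree_le (degree a) (x i * X a - iota u * X (e i + a)).
  move=> a0; exists 1 => //; rewrite rmorph1 mul1r monomial_cons // subrr.
  by move=> c _; exact: coef0.
have [a0|[j [b [aE b0]]]] := exponent_split a.
  by apply: straight => j _; rewrite a0 ffunE.
have [ij|ji] := leqP i j.
  apply: straight => k ki; have kj := leq_trans ki ij.
  by rewrite aE !ffunE b0 // -val_eqE /= ltn_eqF.
have ab : degree a = (degree b).+1 by rewrite aE degreeD degree_unit.
have bm : (degree b < m)%N by rewrite -ab.
have [d [r [t [Td xij]]]] := commutation_coef ji.
have [u Tu hE] := IHm b bm i; set h := _ - _ in hE.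
have xiX : x i * X b = iota u * X (e i + b) + h by rewrite addrC subrK.
exists (d * sigma j u); first by apply: TM => //; exact/sigmaT.
have XE : X (e i + a) = x j * X (e i + b).
  rewrite aE addrCA (@monomial_cons j (e i + b)) // => k kj.
  by rewrite !ffunE b0 // -val_eqE /= ltn_eqF // (ltn_trans kj).
have -> : x i * X a - iota (d * sigma j u) * X (e i + a) =
    iota d * (iota (delta j u) * X (e i + b) + x j * h)
    + (iota r * X b + \sum_(k < n) iota (t k) * (x k * X b)).
  rewrite {1}aE monomial_cons // mulrA xij mulrDl XE.
  have -> : iota d * (x j * x i) * X b = iota d * (iota (sigma j u) *
      (x j * X (e i + b)) + (iota (delta j u) * X (e i + b) + x j * h)).
    rewrite -!mulrA xiX mulrDr [x j * (iota u * _)]mulrA commuteP mulrDl.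
    by rewrite -!mulrA addrA.
  have -> : (iota r + \sum_(k < n) iota (t k) * x k) * X b =
      iota r * X b + \sum_(k < n) iota (t k) * (x k * X b).
    by rewrite mulrDl mulr_suml; under eq_bigr do rewrite -mulrA.
  by rewrite mulrDr rmorphM -mulrA addrC !addrA addNr add0r.
rewrite ab; apply: degree_leD.
  apply/degree_leZ/degree_leD; last exact: up.
  by apply/degree_leZ/degree_leX; rewrite degreeD degree_unit.
apply: degree_leD; first exact/degree_leZ/degree_leX.
by apply: degree_le_sum => k; apply/degree_leZ/up => //; exact: degree_leX.
Qed.


Lemma coef_var_monomial_lead a i : T (coef (x i * X a) (e i + a)).
Proof.
have [u Tu /(_ (e i + a))] := straightening a i.
rewrite coefB coefZ coefX eqxx mulr1 degreeD degree_unit add1n ltnSn => /(_ isT)/eqP.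
by rewrite subr_eq0 => /eqP ->.
Qed.

Lemma coef_var_monomial_gt a i c : (deglex (e i + a) < deglex c)%O ->
  coef (x i * X a) c = 0.
Proof.
move=> ac; have [u Tu /(_ c)] := straightening a i.
rewrite coefB coefZ coefX.
have [eac|_] := eqVneq (e i + a) c.
  by rewrite eac Order.POrderTheory.ltxx in ac.
rewrite mulr0 subr0; apply; rewrite ltnNge; apply/negP => ca.
have /deglex_lt_degree : (degree c < degree (e i + a)%R)%N.
  by rewrite degreeD degree_unit.
by move=> /(Order.POrderTheory.lt_trans ac); rewrite Order.POrderTheory.ltxx.
Qed.

(** The leading exponent is taken modulo the prime ideal complementary to [T]. *)
Definition leading f a :=
  T (coef f a) /\ forall c, (deglex a < deglex c)%O -> ~ T (coef f c).

Let compl_sum (s : seq exponent) (F : exponent -> R) :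
  (forall a, a \in s -> ~ T (F a)) -> ~ T (\sum_(a <- s) F a).
Proof.
move=> TF; rewrite big_seq.
exact: (maximal_multiplicative_compl_sum R_reduced maxT).
Qed.

Let T_sum (s : seq exponent) (F : exponent -> R) a : uniq s -> a \in s ->
  T (F a) -> (forall c, c \in s -> c != a -> ~ T (F c)) -> T (\sum_(c <- s) F c).
Proof.
move=> us sa TFa TF; rewrite (bigD1_seq a) //=.
apply/(maximal_multiplicative_mem_addr R_reduced maxT) => //.
rewrite big_seq_cond; apply: (maximal_multiplicative_compl_sum R_reduced maxT).
by move=> c /andP[]; exact: TF.
Qed.

Let leading_mem f s a : f = \sum_(a <- s) iota (coef f a) * X a ->
  T (coef f a) -> a \in s.
Proof.
move=> fE Ta; apply: contrapT => /negP /(coef_outside fE) fa0.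
by apply: T0; rewrite -fa0.
Qed.

(** Coefficients of [g] at exponents above [b] are outside [T] and stay so under
    [sigma i] and [delta i]; those at exponents below [b] contribute only below
    [e i + b]. *)
Lemma leading_var_mul i g b : leading g b -> leading (x i * g) (e i + b).
Proof.
move=> [Tb gtb]; have [s us gE] := coef_span g.
have delta_part a c : (deglex b < deglex c)%O ->
    ~ T (delta i (coef g a) * (a == c)%:R).
  move=> bc; have [->|_] := eqVneq a c; last by rewrite mulr0.
  by rewrite mulr1; apply: deltaT; exact: gtb.
have bib : (deglex b < deglex (e i + b))%O.
  by apply: deglex_lt_degree; rewrite degreeD degree_unit.
have T_add := maximal_multiplicative_complD R_reduced maxT.
split=> [|c bc]; rewrite (coef_var_mul _ _ gE).
  apply: (T_sum (a := b)) => //; first exact: leading_mem gE _.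
    apply/(maximal_multiplicative_mem_addr R_reduced maxT); first exact: delta_part.
    by apply: TM; [exact/sigmaT|exact: coef_var_monomial_lead].
  move=> a sa ab; apply: T_add; last exact: delta_part.
  have [ab'|ba] := Order.TotalTheory.leP (deglex a) (deglex b); last first.
    by apply: complMr => /sigmaT; exact: gtb.
  rewrite coef_var_monomial_gt ?mulr0 //.
  rewrite addrC [e i + b]addrC; apply: deglex_ltD.
  by rewrite Order.POrderTheory.lt_neqAle ab' (inj_eq (@deglex_inj n)) ab.
apply: compl_sum => a sa; apply: T_add; last first.
  by apply: delta_part; exact: Order.POrderTheory.lt_trans bib bc.
have [ab|ba] := Order.TotalTheory.leP (deglex a) (deglex b); last first.
  by apply: complMr => /sigmaT; exact: gtb.
rewrite coef_var_monomial_gt ?mulr0 //.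
apply: Order.POrderTheory.le_lt_trans bc.
by rewrite addrC [e i + b]addrC; exact: deglex_leD.
Qed.

Lemma leading_monomial_mul a g b : leading g b -> leading (X a * g) (a + b).
Proof.
have [m] := ubnP (degree a); elim: m a => // m IHm a am gb.
have [->|[j [a' [aE a'0]]]] := exponent_split a.
  by rewrite monomial0 mul1r add0r.
rewrite aE monomial_cons // -mulrA -addrA; apply/leading_var_mul/IHm => //.
by move: am; rewrite aE degreeD degree_unit.
Qed.

Lemma leading_mul f g a b : leading f a -> leading g b -> leading (f * g) (a + b).
Proof.
move=> [Ta gta] gb; have [s us fE] := coef_span f.
have low d c : (deglex d <= deglex a)%O -> (deglex (d + b) < deglex c)%O ->
    ~ T (coef f d * coef (X d * g) c).
  by move=> da dc; apply: complMl; have [_] := leading_monomial_mul d gb; exact.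
have high d c : (deglex a < deglex d)%O -> ~ T (coef f d * coef (X d * g) c).
  by move=> ad; apply: complMr; exact: gta.
split=> [|c abc]; rewrite (coef_mul _ _ fE).
  apply: (T_sum (a := a)) => //; first exact: leading_mem fE _.
    by apply: TM => //; have [] := leading_monomial_mul a gb.
  move=> d sd da.
  have [da'|] := Order.TotalTheory.leP (deglex d) (deglex a); last exact: high.
  apply: low => //; apply: deglex_ltD.
  by rewrite Order.POrderTheory.lt_neqAle da' (inj_eq (@deglex_inj n)) da.
apply: compl_sum => d sd.
have [da|] := Order.TotalTheory.leP (deglex d) (deglex a); last exact: high.
apply: low => //; apply: Order.POrderTheory.le_lt_trans abc; exact: deglex_leD.
Qed.

Lemma exists_leading f c : T (coef f c) -> exists a, leading f a.
Proof.
move=> Tc; have [s us fE] := coef_span f.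
have [a Ta amax] := deglex_max (P := fun a => T (coef f a)) (leading_mem fE Tc) Tc.
exists a; split=> // d ad Td.
have := amax d (leading_mem fE Td) Td.
by rewrite Order.TotalTheory.leNgt ad.
Qed.

(** * The J-prime ideal attached to a maximal multiplicative set *)

Lemma compl_mul_left f g :
  (forall c, ~ T (coef g c)) -> forall c, ~ T (coef (f * g) c).
Proof.
move=> Tg c; have [s us fE] := coef_span f.
rewrite (coef_mul _ _ fE); apply: compl_sum => a sa; apply: complMl.
move: c; have [m] := ubnP (degree a); elim: m a {sa} => // m IHm a am c.
have [->|[j [b [aE b0]]]] := exponent_split a; first by rewrite monomial0 mul1r.
have {}IHm := IHm b; rewrite aE monomial_cons // -mulrA.
have [t ut hE] := coef_span (X b * g).
rewrite (coef_var_mul _ _ hE); apply: compl_sum => d td.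
have Td : ~ T (coef (X b * g) d).
  by apply: IHm; move: am; rewrite aE degreeD degree_unit.
apply: (maximal_multiplicative_complD R_reduced maxT); apply: complMr.
  by move/sigmaT.
exact: deltaT.
Qed.

(** The extension [pA] to [A] of the prime ideal [p] complementary to [T]. *)
Definition compl_ideal : ideal A.
Proof.
exists [set f | forall c, ~ T (coef f c)].
- by move=> c; rewrite coef0.
- move=> f g Tf Tg c; rewrite coefB.
  exact: (maximal_multiplicative_complB R_reduced maxT).
- by move=> f g; exact: compl_mul_left.
- move=> f g Tf c; have [s us fE] := coef_span f.
  by rewrite (coef_mul _ _ fE); apply: compl_sum => a sa; exact: complMr.
Defined.

Lemma compl_idealP f : ~ (compl_ideal : set A) f -> exists a, leading f a.
Proof. by move=> /existsNP[c /contrapT]; exact: exists_leading. Qed.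

Lemma leading_compl_ideal f a : leading f a -> ~ (compl_ideal : set A) f.
Proof. by move=> [Ta _] /(_ a). Qed.

Lemma coef1 c : coef 1 c = (0 == c)%:R.
Proof. by rewrite -monomial0 coefX. Qed.

Lemma compl_ideal_neq1 : ~ (compl_ideal : set A) 1.
Proof. by move=> /(_ 0); rewrite coef1 eqxx. Qed.

Lemma compl_ideal_prime : prime_ideal compl_ideal.
Proof.
split=> [|I J IJ]; first exact/ideal_neqT/compl_ideal_neq1.
apply: contrapT => /not_orP[/nonsubset[f [If nf]] /nonsubset[g [Jg ng]]].
have [a fa] := compl_idealP nf; have [b gb] := compl_idealP ng.
exact: leading_compl_ideal (leading_mul fa gb) (IJ _ _ If Jg).
Qed.

(** If [f], nonzero modulo the ideal, represented an element of the radical,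
    then [x i * f - 1] would be left invertible in the quotient. Its leading
    exponent is nonzero, since it involves [i], and leading exponents add up,
    whereas that of [1] is zero. *)
Lemma compl_ideal_J_prime : (0 < n)%N -> J_prime compl_ideal.
Proof.
move=> n_gt0; split; first exact: compl_ideal_prime.
set Q := ring_quot compl_ideal; pose i := Ordinal n_gt0.
apply/seteqP; split=> [q Jq|_ -> L [[L0 _ _] _ _]//].
have [f qE] : exists f, q = \pi_Q f by exists (repr q); rewrite reprK.
rewrite qE; apply/pi_quot0; apply: contrapT => /compl_idealP[a fa].
have coef1_pos b : coef 1 (b + (e i + a)) = 0.
  rewrite coef1; case: eqP => // /(congr1 (@degree n)).
  rewrite !degreeD degree_unit add1n addnS /degree big1 // => k _.
  by rewrite ffunE.
have leading_sub1 g b :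
    leading g (b + (e i + a)) -> leading (g - 1) (b + (e i + a)).
  move=> [Tg gtg]; split=> [|c bc]; first by rewrite coefB coef1_pos subr0.
  rewrite coefB coef1; case: eqP bc => [<-|_ bc]; last by rewrite subr0; exact: gtg.
  have /deglex_lt_degree : (degree (0%R : exponent) < degree (b + (e i + a))%R)%N.
    rewrite !degreeD degree_unit add1n addnS /degree big1 // => k _.
    by rewrite ffunE.
  by move=> /Order.POrderTheory.lt_trans h /h; rewrite Order.POrderTheory.ltxx.
pose y := x i * f - 1.
have ly : leading y (e i + a).
  rewrite -[e i + a]add0r; apply: leading_sub1.
  by rewrite add0r; exact: leading_var_mul.
pose L := [set p : Q | exists v, p = \pi_Q (v * y)].
have L1 : ~ L 1.
  move=> [v v1]; have vy1 : (compl_ideal : set A) (v * y - 1).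
    by apply/pi_quot0; rewrite raddfB /= -v1 pi_quot1 subrr.
  have [Iv|/compl_idealP[b vb]] := pselect ((compl_ideal : set A) v).
    apply: compl_ideal_neq1; rewrite -(subKr (v * y) 1).
    by apply: idealB => //; exact: idealMr.
  exact: leading_compl_ideal (leading_sub1 _ _ (leading_mul vb ly)) vy1.
have [|L' [mL' LL']] := @exists_maximal_left_ideal Q L _ L1.
  split=> [|_ _ [v ->] [w ->]|r' _ [v ->]].
  - by exists 0; rewrite mul0r raddf0.
  - by exists (v - w); rewrite mulrBl raddfB.
  - by exists (repr r' * v); rewrite -mulrA [RHS]pi_quotM reprK.
have [[_ L'B L'M] /eqP L'T _] := mL'; apply: L'T.
suff L'1 : L' 1 by apply/seteqP; split=> // p _; rewrite -(mulr1 p); exact: L'M.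
have -> : 1 = \pi_Q (x i) * q - \pi_Q y :> Q.
  by rewrite qE -pi_quotM -pi_quot1 -raddfB /= /y subKr.
apply: L'B; first by apply: L'M; exact: Jq.
by apply: LL'; exists 1; rewrite mul1r.
Qed.

Lemma compl_ideal_sub (M : ideal A) :
  (forall r, ~ T r -> (M : set A) (iota r)) -> compl_ideal `<=` M.
Proof.
move=> TM' f Tf; have [s us ->] := coef_span f.
elim/big_ind: _ => [|g h|a _]; first exact: ideal0.
  exact: idealD.
by apply: idealMr; apply: TM'; exact: Tf.
Qed.

Lemma compl_ideal_iota r : ~ T r -> (compl_ideal : set A) (iota r).
Proof. by move=> Tr c; rewrite -(mulr1 (iota r)) coefZ; exact: complMr. Qed.

End SkewPBW.

(** * Separation of the maximal ideals *)

(** The witness is a product of the elements of [s] with suitable factors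
    inserted between them. *)
Lemma prime_ideal_common_multiple (B : pzRingType) (P : ideal B) (s : seq B) :
  prime_ideal P -> (forall c, c \in s -> ~ (P : set B) c) ->
  exists a, ~ (P : set B) a /\
    forall (K : ideal B) c, c \in s -> (K : set B) c -> (K : set B) a.
Proof.
move=> primeP; elim: s => [_|c s IHs Ps].
  by exists 1; split=> //; exact/ideal_neqT/primeP.1.
have [|a [Pa aK]] := IHs; first by move=> d ds; apply: Ps; rewrite inE ds orbT.
have Pc : ~ (P : set B) c by apply: Ps; exact: mem_head.
have [r Pr] := prime_ideal_mulP primeP Pc Pa.
exists (c * r * a); split=> // K d; rewrite inE => /orP[/eqP ->|ds Kd].
  by move=> Kc; rewrite -mulrA; exact: idealMr.
by apply: idealMl; exact: aK Kd.
Qed.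

(** The hypotheses on [K] say that [K T] behaves as the extension to [A] of the
    prime ideal complementary to [T], is J-prime, and that these extensions
    intersect in zero. If the set [S] of the products of elements of [R] outside
    [M] or outside [N] did not contain [0], a maximal multiplicative set above
    it would give a J-prime ideal inside both [M] and [N]. *)
Lemma J_pm_annihilator_separated (R A : pzRingType) (iota : {rmorphism R -> A})
    (K : forall T : set R, maximal_multiplicative_set T -> ideal A) :
  (forall T (maxT : maximal_multiplicative_set T), J_prime (K T maxT)) ->
  (forall T (maxT : maximal_multiplicative_set T) r,
     ~ T r -> (K T maxT : set A) (iota r)) ->
  (forall T (maxT : maximal_multiplicative_set T) (M : ideal A),
     (forall r, ~ T r -> (M : set A) (iota r)) -> K T maxT `<=` M) ->
  (forall f, (forall T (maxT : maximal_multiplicative_set T),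
     (K T maxT : set A) f) -> f = 0) ->
  J_pm A -> annihilator_separated A.
Proof.
move=> JK Kiota Ksub Kcap pmA M N maxM maxN MN.
pose outside r := ~ (M : set A) (iota r) \/ ~ (N : set A) (iota r).
pose S := [set r | exists2 s : seq R,
  forall t, t \in s -> outside t & r = \prod_(t <- s) t].
have [[s sout s0]|S0] := pselect (S 0); last first.
  have [|T [maxT ST]] := @exists_maximal_multiplicative_set R S.
    split=> //; first by exists [::]; rewrite ?big_nil.
    move=> _ _ [s so ->] [t to ->]; exists (s ++ t); last by rewrite big_cat.
    by move=> r; rewrite mem_cat => /orP[/so|/to].
  have notT r : ~ T r -> ~ outside r.
    move=> Tr ro; apply: Tr; apply: ST; exists [:: r]; last by rewrite big_seq1.
    by move=> t; rewrite inE => /eqP ->.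
  have KM : K T maxT `<=` M.
    by apply: Ksub => // r /notT /not_orP[/contrapT].
  have KN : K T maxT `<=` N.
    by apply: Ksub => // r /notT /not_orP[_ /contrapT].
  have [M0 [_ uniqM0]] := pmA _ (JK T maxT).
  by case: MN; rewrite -(uniqM0 M) // (uniqM0 N).
(* A common multiple of the factors that are outside [P]. *)
have common (P : ideal A) : maximal_ideal P -> exists a, ~ (P : set A) a /\
    forall (I : ideal A) r, r \in s -> ~ (P : set A) (iota r) ->
    (I : set A) (iota r) -> (I : set A) a.
  move=> /maximal_ideal_prime primeP.
  have [|a [Pa aI]] := prime_ideal_common_multiple
      (s := [seq iota r | r <- s & `[< ~ (P : set A) (iota r) >]]) primeP.
    by move=> c /mapP[r]; rewrite mem_filter => /andP[/asboolP Pr _] ->.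
  exists a; split=> // I r rs Pr; apply: aI; apply: map_f.
  by rewrite mem_filter rs andbT; exact/asboolP.
have [a [Ma aI]] := common M maxM; have [b [Nb bI]] := common N maxN.
exists a, b; split=> // r; apply: Kcap => T maxT.
have [t ts Tt] : exists2 t, t \in s & ~ T t.
  have [[T1 TM T0] _] := maxT.
  apply: contrapT => noT; apply: T0; rewrite s0 big_seq.
  apply: (big_ind T) => // t ts; apply: contrapT => Tt; apply: noT.
  by exists t.
have Kt := Kiota T maxT t Tt.
have [Mt|Nt] := sout t ts; [apply/idealMr/idealMr|apply/idealMl].
  exact: aI Kt.
exact: bI Kt.
Qed.

Lemma sigma_exp_unit (R : pzRingType) (n : nat)
    (sigma : 'I_n -> {rmorphism R -> R}) (i : 'I_n) :
  sigma_exp sigma (unit_exponent i) = sigma i.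
Proof.
rewrite /sigma_exp.
have : uniq (index_enum 'I_n) by exact: index_enum_uniq.
have : i \in index_enum 'I_n by exact: mem_index_enum.
elim: (index_enum 'I_n) => // j s IHs; rewrite inE big_cons /= ffunE.
have [<- _ /andP[si us]|ij /= si /andP[_ us]] := eqVneq i j; last first.
  by rewrite IHs.
apply/funext => r /=; congr (sigma i _).
elim: s si {IHs us} => [|k s IHs]; first by rewrite big_nil.
rewrite inE negb_or big_cons ffunE eq_sym => /andP[/negbTE -> /IHs].
by [].
Qed.

Theorem proposition5p4 (R A : pzRingType) (iota : {rmorphism R -> A})
    (n : nat) (x : 'I_n -> A) (sigma : 'I_n -> {rmorphism R -> R})
    (n_gt0 : (0 < n)%N)
    (A_skew_PBW : skew_PBW_extension iota x)
    (sigmaP : associated_endomorphisms iota x sigma)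
    (R_semicommutative : Sigma_semicommutative sigma)
    (R_reduced : reduced_ring R) :
  [<-> J_pm A; normal_space (JSpec A); retract_of (Max A)].
Proof.
have [coef [coefD coefZ coefX coef_span]] :=
  left_basis_coordinates (skew_PBW_basis A_skew_PBW).
have [delta deltaP] := choice (fun i => let: conj _ (ex_intro2 d dP dE) := sigmaP i in
  ex_intro (fun d => skew_derivation (sigma i) d /\ forall r,
    x i * iota r = iota (sigma i r) * x i + iota (d r)) d (conj dP dE)).
have sigma_inj i : injective (sigma i) by have [] := sigmaP i.
have compatible i a b : a * b = 0 -> a * sigma i b = 0.
  move=> ab; rewrite -(mulr1 a) -sigma_exp_unit; apply: R_semicommutative => //.
  by apply/eqP => /ffunP /(_ i); rewrite !ffunE eqxx.
pose dP i := (deltaP i).1; pose cP i := (deltaP i).2.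
tfae.
- move=> pmA; apply: annihilator_separated_normal.
  pose K T (maxT : maximal_multiplicative_set T) := compl_ideal sigma_inj dP cP
    compatible R_reduced coefD coefZ coefX coef_span maxT.
  apply: (@J_pm_annihilator_separated R A iota K) => //.
  + by move=> T maxT; exact: compl_ideal_J_prime.
  + by move=> T maxT r; exact: compl_ideal_iota.
  + by move=> T maxT M; exact: compl_ideal_sub.
  + move=> f Kf; have [s us ->] := coef_span f.
    rewrite big1 // => a _; rewrite (_ : coef f a = 0) ?rmorph0 ?mul0r //.
    by apply: reduced_maximal_multiplicative_cap => // T maxT; exact: Kf.
- exact: normal_retract.
- exact: retract_J_pm.
Qed.
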